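(* Let $K=K_1\cup\dots\cup K_s\subset\mathbb{R}^N$ ($N\ge 2$, $s\ge 3$) be an open billiard configuration, let $\Sigma$ be its symbol space with left shift $\sigma$, and let $\phi:\Sigma\to\mathbb{R}^N$ be the observable assigning to $\xi$ the starting point $y\in\partial K_{\xi_0}$ of the billiard trajectory coded by $\xi$. Then the general rotation set $G_\phi$ is convex, and the set $P_\phi$ of all convex combinations of rotation vectors of periodic elements of $\Sigma$ is dense in $G_\phi$.
   Context: An open billiard configuration: $K_1,\dots,K_s$ are pairwise disjoint compact strictly convex subsets of $\mathbb{R}^N$ with $C^2$-smooth boundaries, satisfying the no-eclipse condition: for any pairwise distinct $i,j,k$, the convex hull of $K_i\cup K_j$ does not intersect $K_k$. The billiard takes place in $\Omega=\mathbb{R}^N\setminus K$, with specular reflection at $\partial K$. The symbol space $\Sigma$ is the set of bi-infinite sequences $\xi=(\xi_i)_{i\in\mathbb{Z}}$ with $\xi_i\in\{1,\dots,s\}$ and $\xi_i\neq\xi_{i+1}$ for all $i$; $\sigma$ is the left shift $(\sigma\xi)_i=\xi_{i+1}$. For each $\xi\in\Sigma$ there is a unique pair $(y,v)$, $y\in\partial K$, $v$ a unit vector, such that the billiard trajectory issued from $y$ in direction $v$ has infinitely many reflections forwards and backwards and its $i$-th reflection is at $\partial K_{\xi_i}$ for every $i\in\mathbb{Z}$ (the $0$-th being at $y$); define $\phi(\xi)=y$. For $\xi\in\Sigma$, the rotation vector is $\rho_\phi(\xi)=\lim_{n\to\infty}\frac1n\sum_{i=0}^{n-1}\phi(\sigma^i\xi)$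 when this limit exists. The general rotation set $G_\phi$ is the set of all limits of convergent subsequences of the sequences $\big(\frac1n\sum_{i=0}^{n-1}\phi(\sigma^i\xi)\big)_{n\ge1}$, over all $\xi\in\Sigma$. An element $\xi\in\Sigma$ is periodic if $\sigma^p\xi=\xi$ for some $p>0$. $P_\phi$ is the set of all points $\sum_{i=1}^k t_i\rho_\phi(\xi_i)$ with $k\ge1$, $\xi_1,\dots,\xi_k$ periodic, $t_i\ge0$, $\sum t_i=1$. *)

(* Defs.v *)
From HB Require Import structures.
From mathcomp Require Import all_boot all_order all_algebra.
From mathcomp Require Import all_classical all_reals all_analysis.
Set Implicit Arguments. Unset Strict Implicit. Unset Printing Implicit Defensive.
Import Order.TTheory GRing.Theory Num.Theory.
Import numFieldNormedType.Exports.
Local Open Scope classical_set_scope.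
Local Open Scope ring_scope.

Section Billiard.
Variables (R : realType) (N : nat).
Notation vec := 'rV[R]_N.

Definition dotp (u v : vec) : R := \sum_(i < N) u ord0 i * v ord0 i.
Definition enorm (u : vec) : R := Num.sqrt (dotp u u).

Definition ebasis (i : 'I_N) : vec := delta_mx ord0 i.

Definition pder (f : vec -> R) (i : 'I_N) (x : vec) : R := derive f x (ebasis i).

Definition C2_on (U : set vec) (f : vec -> R) : Prop :=
  forall x, U x ->
    [/\ {for x, continuous f},
        (forall i, derivable f x (ebasis i)),
        (forall i, {for x, continuous (pder f i)}),
        (forall i j, derivable (pder f i) x (ebasis j)) &
        (forall i j, {for x, continuous (pder (pder f i) j)})].

Definition is_convex (A : set vec) : Prop :=
  forall x y (t : R), A x -> A y -> 0 <= t <= 1 -> A ((1 - t) *: x + t *: y).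

Definition strictly_convex_set (A : set vec) : Prop :=
  forall x y (t : R), A x -> A y -> x != y -> 0 < t < 1 ->
    (A°) ((1 - t) *: x + t *: y).

Definition C2_boundary (A : set vec) : Prop :=
  forall p, (closure A `\` A°) p ->
    exists (U : set vec) (F : vec -> R),
      [/\ open U, U p, C2_on U F,
          (exists i, pder F i p != 0) &
          (forall x, U x -> (A x <-> F x <= 0))].

Definition conv_hull (A : set vec) : set vec :=
  [set x | forall C, is_convex C -> A `<=` C -> C x].

Definition open_billiard (s : nat) (K : 'I_s -> set vec) : Prop :=
  [/\ (forall i, K i !=set0) /\ (forall i, compact (K i)),
      (forall i, is_convex (K i)),
      (forall i, strictly_convex_set (K i)) /\ (forall i, C2_boundary (K i)),
      (forall i j, i != j -> K i `&` K j = set0) &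
      (forall i j k, i != j -> j != k -> i != k ->
          conv_hull (K i `|` K j) `&` K k = set0)].

Definition Kunion (s : nat) (K : 'I_s -> set vec) : set vec :=
  \bigcup_(i in setT) K i.

Definition outer_unit_normal (A : set vec) (p n : vec) : Prop :=
  enorm n = 1 /\ forall z, A z -> dotp (z - p) n <= 0.

Definition reflects (A : set vec) (a p b : vec) : Prop :=
  let u := (enorm (p - a))^-1 *: (p - a) in
  let w := (enorm (b - p))^-1 *: (b - p) in
  exists n, outer_unit_normal A p n /\ w = u - (2 * dotp u n) *: n.

Definition admissible (s : nat) (xi : int -> 'I_s) : Prop :=
  forall i : int, xi i != xi (i + 1)%R.

Definition shift (s : nat) (xi : int -> 'I_s) : int -> 'I_s :=
  fun i => xi (i + 1)%R.

Definition periodic (s : nat) (xi : int -> 'I_s) : Prop :=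
  exists p : nat, (0 < p)%N /\ iter p (@shift s) xi = xi.

Definition billiard_orbit (s : nat) (K : 'I_s -> set vec) (xi : int -> 'I_s)
    (x : int -> vec) : Prop :=
  forall i : int,
  [/\ K (xi i) (x i), ~ (K (xi i))° (x i),
      (forall t : R, 0 < t < 1 ->
         ~ Kunion K ((1 - t) *: x i + t *: x (i + 1)%R)) &
      reflects (K (xi i)) (x (i - 1)%R) (x i) (x (i + 1)%R)].

Definition is_coding_observable (s : nat) (K : 'I_s -> set vec)
    (phi : (int -> 'I_s) -> vec) : Prop :=
  forall xi, admissible xi ->
    exists x, billiard_orbit K xi x /\ x 0%R = phi xi.

Definition birkhoff_avg (s : nat) (phi : (int -> 'I_s) -> vec)
    (xi : int -> 'I_s) (n : nat) : vec :=
  (n%:R)^-1 *: \sum_(i < n) phi (iter i (@shift s) xi).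

Definition is_rotation_vector (s : nat) (phi : (int -> 'I_s) -> vec)
    (xi : int -> 'I_s) (v : vec) : Prop :=
  (fun n : nat => birkhoff_avg phi xi n.+1) @ \oo --> v.

Definition gen_rotation_set (s : nat) (phi : (int -> 'I_s) -> vec) : set vec :=
  [set v | exists xi, admissible xi /\
     exists nk : nat -> nat, (forall k, (nk k < nk k.+1)%N) /\
       (fun k => birkhoff_avg phi xi (nk k).+1) @ \oo --> v].

Definition periodic_rotation_hull (s : nat) (phi : (int -> 'I_s) -> vec) : set vec :=
  [set y | exists (k : nat) (xis : 'I_k -> int -> 'I_s) (v : 'I_k -> vec) (t : 'I_k -> R),
     [/\ (0 < k)%N,
         (forall j, admissible (xis j) /\ periodic (xis j)),
         (forall j, is_rotation_vector phi (xis j) (v j)),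
         (forall j, 0 <= t j) /\ \sum_(j < k) t j = 1 &
         y = \sum_(j < k) t j *: v j]].

End Billiard.

(* Main.v *)
(* Two billiard orbits [x], [y] with the same itinerary are critical points of
   the convex length functional. Let [e_i] be the difference of their [i]-th
   unit directions and [S_i = <e_i, y_i - x_i>]. Optimality at the vertices and
   convexity of the norm give [S_(i+1) - S_i >= delta |e_i|^2 >= c S_i^2], which
   is incompatible with the boundedness of [S] unless it is small in the middle
   of a long common itinerary; there the directions, hence (by strict convexity
   and no-eclipse) the reflection points, are close. So the observable is
   uniformly continuous on the symbol space. Since [s >= 3], any two words can
   be joined by one extra symbol, and the rest is specification: the general
   rotation set consists of the vectors approximated by Birkhoff averages over
   arbitrarily long words, equivalently by rotation vectors of periodic
   sequences. *)

Require Import Defs.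
From HB Require Import structures.
From mathcomp Require Import all_boot all_order all_algebra.
From mathcomp Require Import all_classical all_reals all_analysis.
From mathcomp Require Import zify ring lra.
Set Implicit Arguments.
Unset Strict Implicit.
Unset Printing Implicit Defensive.
Import Order.TTheory GRing.Theory Num.Theory.
Import numFieldNormedType.Exports.
Local Open Scope classical_set_scope.
Local Open Scope ring_scope.

(** * The Euclidean inner product *)

Section InnerProduct.
Variables (R : realType) (N : nat).
Implicit Types (u v w : 'rV[R]_N) (c : R).

Lemma dotpC u v : dotp u v = dotp v u.
Proof. by apply: eq_bigr => i _; rewrite mulrC. Qed.

Lemma dotpDl u v w : dotp (u + v) w = dotp u w + dotp v w.
Proof. by rewrite -big_split; apply: eq_bigr => i _; rewrite mxE mulrDl. Qed.

Lemma dotpZl c u w : dotp (c *: u) w = c * dotp u w.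
Proof. by rewrite mulr_sumr; apply: eq_bigr => i _; rewrite mxE mulrA. Qed.

Lemma dotpNl u w : dotp (- u) w = - dotp u w.
Proof. by rewrite -scaleN1r dotpZl mulN1r. Qed.

Lemma dotpDr u v w : dotp w (u + v) = dotp w u + dotp w v.
Proof. by rewrite !(dotpC w) dotpDl. Qed.

Lemma dotpZr c u w : dotp w (c *: u) = c * dotp w u.
Proof. by rewrite !(dotpC w) dotpZl. Qed.

Lemma dotpNr u w : dotp w (- u) = - dotp w u.
Proof. by rewrite !(dotpC w) dotpNl. Qed.

Definition dotpE := (dotpDl, dotpDr, dotpNl, dotpNr, dotpZl, dotpZr).

Lemma dotp_ge0 u : 0 <= dotp u u.
Proof. by apply: sumr_ge0 => i _; rewrite -expr2 sqr_ge0. Qed.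

Lemma dotp_eq0 u : (dotp u u == 0) = (u == 0).
Proof.
apply/eqP/eqP => [uu0|->]; last by rewrite -(scale0r 0) dotpZl mul0r.
apply/rowP => i; rewrite mxE; apply/eqP; rewrite -sqrf_eq0; apply/eqP.
by apply: (psumr_eq0P _ uu0) => // j _; rewrite -expr2 sqr_ge0.
Qed.

Lemma enorm_ge0 u : 0 <= enorm u.
Proof. exact: sqrtr_ge0. Qed.

Lemma sqr_enorm u : enorm u ^+ 2 = dotp u u.
Proof. by rewrite sqr_sqrtr // dotp_ge0. Qed.

Lemma enorm_eq0 u : (enorm u == 0) = (u == 0).
Proof. by rewrite -sqrf_eq0 sqr_enorm dotp_eq0. Qed.

Lemma enorm_gt0 u : (0 < enorm u) = (u != 0).
Proof. by rewrite lt0r enorm_ge0 andbT enorm_eq0. Qed.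

(** Cauchy-Schwarz: the squared norm of [dotp v v *: u - dotp u v *: v] is [dotp v v] times the
    difference of the two sides. *)
Lemma sqr_dotp_le u v : dotp u v ^+ 2 <= dotp u u * dotp v v.
Proof.
have [->|v0] := eqVneq v 0.
  by rewrite -(scale0r (0 : 'rV_N)) !dotpZr !mul0r expr0n mulr0.
have vv : 0 < dotp v v by rewrite lt0r dotp_eq0 v0 dotp_ge0.
have := dotp_ge0 (dotp v v *: u - dotp u v *: v).
rewrite !dotpE (dotpC v u) => h.
rewrite -subr_ge0 -(pmulr_rge0 _ vv); apply: le_trans h _.
by rewrite le_eqVlt; apply/orP; left; apply/eqP; ring.
Qed.

Lemma cvg_dotp (T : Type) (F : set_system T) (FF : Filter F) (f g : T -> 'rV[R]_N) u v :
  f @ F --> u -> g @ F --> v -> dotp (f t) (g t) @[t --> F] --> dotp u v.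
Proof.
move=> cf cg; apply: cvg_big => [|i _]; [exact: add_continuous|].
apply: cvgM.
  exact: (continuous_cvg FF (@coord_continuous _ _ _ ord0 i u) cf).
exact: (continuous_cvg FF (@coord_continuous _ _ _ ord0 i v) cg).
Qed.

Lemma cvg_enorm (T : Type) (F : set_system T) (FF : Filter F) (f : T -> 'rV[R]_N) u :
  f @ F --> u -> enorm (f t) @[t --> F] --> enorm u.
Proof.
move=> cf; exact: (continuous_cvg FF (@sqrt_continuous R _) (cvg_dotp FF cf cf)).
Qed.

(** The shape matches the two unit vectors inside [reflects], so the reflection law folds into
    it. *)
Definition dir (a b : 'rV[R]_N) := (enorm (b - a))^-1 *: (b - a).

Lemma dirE a b : a != b -> b - a = enorm (b - a) *: dir a b.
Proof.
by move=> ab; rewrite /dir scalerA mulfV ?scale1r // enorm_eq0 subr_eq0 eq_sym.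
Qed.

Lemma dotp_dir a b : a != b -> dotp (dir a b) (dir a b) = 1.
Proof.
move=> ab; rewrite /dir dotpZl dotpZr -sqr_enorm expr2 mulKf ?mulVf //;
by rewrite enorm_eq0 subr_eq0 eq_sym.
Qed.

Lemma cvg_dir (T : Type) (F : set_system T) (FF : Filter F) (f g : T -> 'rV[R]_N) u v :
  u != v -> f @ F --> u -> g @ F --> v -> dir (f t) (g t) @[t --> F] --> dir u v.
Proof.
move=> uv cf cg; have cgf : g t - f t @[t --> F] --> v - u by exact: cvgB.
apply: cvgZ => //; apply: cvgV; first by rewrite enorm_eq0 subr_eq0 eq_sym.
exact: cvg_enorm.
Qed.

(* Writing [X = |X| U] and [Y = |Y| V] with unit [U, V], the left side is
   [(|X| + |Y|) (1 - <U, V>)], and [|V - U|^2 = 2 (1 - <U, V>)]. *)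
Lemma dir_monotone a b a' b' (delta : R) : 0 < delta ->
  delta <= enorm (b - a) -> delta <= enorm (b' - a') ->
  delta * dotp (dir a' b' - dir a b) (dir a' b' - dir a b) <=
  dotp (dir a' b' - dir a b) ((b' - b) - (a' - a)).
Proof.
move=> d0 dX dY.
have ab : a != b.
  by rewrite eq_sym -subr_eq0 -enorm_eq0 gt_eqF // (lt_le_trans d0 dX).
have ab' : a' != b'.
  by rewrite eq_sym -subr_eq0 -enorm_eq0 gt_eqF // (lt_le_trans d0 dY).
have -> : (b' - b) - (a' - a) = (b' - a') - (b - a).
  by apply/rowP => i; rewrite !mxE; ring.
have U1 := dotp_dir ab; have V1 := dotp_dir ab'.
rewrite (dirE ab) (dirE ab').
move: dX dY U1 V1 (dotp_ge0 (dir a' b' - dir a b)).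
move: (dir a b) (dir a' b') (enorm _) (enorm _) => U V x y dx dy.
rewrite !dotpE (dotpC U V) => -> ->; move: (dotp V U) => p h; nra.
Qed.

End InnerProduct.

(** * Orbits with a common itinerary *)

(** Once above the threshold [kappa] the sequence stays above it, so the gain [c] recurs at every
    step. It is applied to [S] forwards and to [- S] backwards, to contradict their boundedness. *)
Lemma quadratic_growth (R : realType) (f : nat -> R) (n : nat) (kappa c : R) :
  0 <= c -> (forall k, (k < n)%N -> kappa <= f k -> f k + c <= f k.+1) ->
  kappa <= f 0%N -> forall k, (k <= n)%N -> kappa + k%:R * c <= f k.
Proof.
move=> c0 hf f0; elim=> [|k IH] kn; first by rewrite mul0r addr0.
have fk := IH (ltnW kn); have kc : 0 <= k%:R * c by rewrite mulr_ge0.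
have := hf k kn; rewrite -natr1; lra.
Qed.

Section CriticalOrbits.
Variables (R : realType) (N s : nat) (K : 'I_s -> set 'rV[R]_N).

(* First-order optimality of each [x i] in [K (xi i)] for the length of the
   polygonal line. *)
Definition critical (xi : int -> 'I_s) (x : int -> 'rV[R]_N) :=
  forall i : int, K (xi i) (x i) /\
    forall z, K (xi i) z ->
      0 <= dotp (dir (x (i - 1)) (x i) - dir (x i) (x (i + 1))) (z - x i).

Variables (delta D : R).
Hypothesis delta0 : 0 < delta.
Hypothesis D0 : 0 < D.
Hypothesis separated : forall i j a b, i != j -> K i a -> K j b -> delta <= enorm (b - a).
Hypothesis diameter : forall i a b, K i a -> K i b -> enorm (b - a) <= D.

Section TwoOrbits.
Variables (xi eta : int -> 'I_s) (x y : int -> 'rV[R]_N).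
Hypothesis xi_adm : admissible xi.
Hypothesis eta_adm : admissible eta.
Hypothesis x_crit : critical xi x.
Hypothesis y_crit : critical eta y.

Let e i := dir (y i) (y (i + 1)) - dir (x i) (x (i + 1)).
Let S i := dotp (e i) (y i - x i).

(** Testing the optimality of each orbit at [i + 1] against the other orbit's point and adding gives
    [S (i + 1) >= dotp (e i) (y (i + 1) - x (i + 1))]. The right side exceeds [S i] by the quantity
    that [dir_monotone] bounds below. Both tests take place in one obstacle, hence the agreement at
    [i + 1]. *)
Lemma edge_gain i : xi (i + 1) = eta (i + 1) ->
  S i + delta * dotp (e i) (e i) <= S (i + 1).
Proof.
move=> E.
have [x1 fx] := x_crit (i + 1); have [y1 fy] := y_crit (i + 1).
have [x0 _] := x_crit i; have [y0 _] := y_crit i.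
have h := dir_monotone delta0 (separated (xi_adm i) x0 x1) (separated (eta_adm i) y0 y1).
have := fx (y (i + 1)); have := fy (x (i + 1)); rewrite E => /(_ _)/wrap[]; first by rewrite -E.
move=> fy' /(_ y1) fx'.
move: h fx' fy'; rewrite /S -/(e i) addrK.
have -> : dir (x i) (x (i + 1)) = dir (y i) (y (i + 1)) - e i by rewrite /e subKr.
have -> : dir (x (i + 1)) (x (i + 1 + 1)) = dir (y (i + 1)) (y (i + 1 + 1)) - e (i + 1).
  by rewrite /e subKr.
move: (x i) (x (i + 1)) (y i) (y (i + 1)) (e i) (e (i + 1)) (dir _ _) (dir _ _).
move=> p q p' q' e0 e1 U V; rewrite !dotpE; lra.
Qed.

Lemma sqr_edge_le i : dotp (e i) (e i) <= 4.
Proof.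
have [x1 _] := x_crit (i + 1); have [y1 _] := y_crit (i + 1).
have [x0 _] := x_crit i; have [y0 _] := y_crit i.
have dist i0 j0 a b : i0 != j0 -> K i0 a -> K j0 b -> a != b.
  move=> ij Ka Kb; rewrite eq_sym -subr_eq0 -enorm_eq0 gt_eqF //.
  exact: lt_le_trans delta0 (separated ij Ka Kb).
have U1 := dotp_dir (dist _ _ _ _ (xi_adm i) x0 x1).
have V1 := dotp_dir (dist _ _ _ _ (eta_adm i) y0 y1).
(* For unit vectors the squared norms of sum and difference add up to 4. *)
have := dotp_ge0 (dir (y i) (y (i + 1)) + dir (x i) (x (i + 1))).
by rewrite /e; move: U1 V1; move: (dir _ _) (dir _ _) => U V; rewrite !dotpE (dotpC V U); lra.
Qed.

Lemma sqr_S_le i : xi i = eta i -> S i ^+ 2 <= D ^+ 2 * dotp (e i) (e i).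
Proof.
move=> E; have [x0 _] := x_crit i; have [y0 _] := y_crit i.
apply: le_trans (sqr_dotp_le _ _) _; rewrite mulrC ler_wpM2r ?dotp_ge0 //.
rewrite -sqr_enorm ler_sqr ?nnegrE ?enorm_ge0 ?(ltW D0) //.
by apply: (@diameter (eta i)) => //; rewrite -E.
Qed.

Lemma norm_S_le i : xi i = eta i -> `|S i| <= 2 * D.
Proof.
move=> E; rewrite -ler_sqr ?nnegrE ?mulr_ge0 ?(ltW D0) //.
rewrite real_normK ?num_real //; apply: le_trans (sqr_S_le E) _.
by have := sqr_edge_le i; rewrite exprMn mulrC => h; rewrite ler_wpM2r ?sqr_ge0 //; lra.
Qed.

Lemma edge_gain_sqr i : xi i = eta i -> xi (i + 1) = eta (i + 1) ->
  S i + delta / D ^+ 2 * S i ^+ 2 <= S (i + 1).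
Proof.
move=> E E1; apply: le_trans (edge_gain E1); rewrite lerD2l -mulrA ler_pM2l //.
by rewrite mulrC ler_pdivrMr ?exprn_gt0 // mulrC; exact: sqr_S_le.
Qed.

End TwoOrbits.

(** On the common word [S] is bounded by [2 * D]. If [S 1] reached [kappa] it would grow past this
    bound to the right; if [S (- 1)] reached [- kappa], the same would happen to the left. So [S]
    rises by less than [2 * kappa] from -1 to 1, and this rise dominates the gains of the two edges
    at vertex 0. *)
Lemma close_dirs (eps : R) : 0 < eps -> exists m : nat,
  forall xi eta x y, admissible xi -> admissible eta ->
    critical xi x -> critical eta y ->
    (forall i : int, `|i| <= m%:Z -> xi i = eta i) ->
    forall i : int, - 1 <= i <= 0 ->
    dotp (dir (y i) (y (i + 1)) - dir (x i) (x (i + 1)))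
         (dir (y i) (y (i + 1)) - dir (x i) (x (i + 1))) <= eps.
Proof.
move=> eps0.
(* Chosen so that [2 * kappa = delta * eps]; [c] is then the quadratic gain at level [kappa]. *)
pose kappa := delta * eps / 2; have kappa0 : 0 < kappa by rewrite /kappa; have := mulr_gt0 delta0 eps0; lra.
pose c := delta / D ^+ 2 * kappa ^+ 2.
have c0 : 0 < c by rewrite /c mulr_gt0 ?divr_gt0 ?exprn_gt0.
have dD0 : 0 <= delta / D ^+ 2 by rewrite divr_ge0 ?exprn_ge0 ?(ltW D0) ?(ltW delta0).
have [n nc] : exists n : nat, 2 * D < n%:R * c.
  by exists (Num.truncn (2 * D / c)).+1; rewrite -ltr_pdivrMr //; apply: truncnS_gt.
exists n.+2 => xi eta x y xia eta_a xc yc agree.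
pose S i := dotp (dir (y i) (y (i + 1)) - dir (x i) (x (i + 1))) (y i - x i).
have gain i : xi i = eta i -> xi (i + 1) = eta (i + 1) ->
    S i + delta / D ^+ 2 * S i ^+ 2 <= S (i + 1).
  exact: edge_gain_sqr.
have bound i : xi i = eta i -> `|S i| <= 2 * D by exact: norm_S_le.
have right : S 1 < kappa.
  rewrite ltNge; apply/negP => h.
  have hf k : (k < n)%N -> kappa <= S (1 + k%:Z) -> S (1 + k%:Z) + c <= S (1 + k.+1%:Z).
    move=> kn hk.
    have -> : 1 + k.+1%:Z = 1 + k%:Z + 1 by clear; lia.
    apply: le_trans (gain _ _ _);
      [|apply: agree; move: kn; clear; lia|apply: agree; move: kn; clear; lia].
    rewrite lerD2l /c ler_wpM2l //.
    by rewrite ler_sqr ?nnegrE ?(ltW kappa0) // (le_trans (ltW kappa0)).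
  have := quadratic_growth (ltW c0) hf h (leqnn n).
  have := bound (1 + n%:Z) (agree (1 + n%:Z) ltac:(clear; lia)).
  rewrite ler_norml => /andP[_]; lra.
have left_ : - kappa < S (- 1).
  rewrite ltNge; apply/negP => h.
  have hf k : (k < n)%N -> kappa <= - S (- 1 - k%:Z) ->
      - S (- 1 - k%:Z) + c <= - S (- 1 - k.+1%:Z).
    move=> kn hk.
    have := gain (- 1 - k.+1%:Z) (agree (- 1 - k.+1%:Z) ltac:(move: kn; clear; lia))
      (agree (- 1 - k.+1%:Z + 1) ltac:(move: kn; clear; lia)).
    have -> : - 1 - k.+1%:Z + 1 = - 1 - k%:Z by clear; lia.
    move=> g.
    (* Going left, the gain is evaluated at the farther index; its mere nonnegativity first carries
       the bound [kappa] over to that index. *)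
    have q : kappa <= - S (- 1 - k.+1%:Z).
      by have := mulr_ge0 dD0 (sqr_ge0 (S (- 1 - k.+1%:Z))); lra.
    have : c <= delta / D ^+ 2 * S (- 1 - k.+1%:Z) ^+ 2.
      rewrite /c ler_wpM2l // -[leRHS]sqrrN ler_sqr ?nnegrE ?(ltW kappa0) //.
      by rewrite (le_trans (ltW kappa0)).
    lra.
  have h0 : kappa <= - S (- 1 - 0%:Z) by rewrite subr0; lra.
  have := quadratic_growth (ltW c0) hf h0 (leqnn n).
  have := bound (- 1 - n%:Z) (agree (- 1 - n%:Z) ltac:(clear; lia)).
  rewrite ler_norml => /andP[h1 _]; lra.
(* The gains of edges -1 and 0 telescope to [S 1 - S (- 1)], so each alone is below
   [delta * eps]. *)
have g0 := edge_gain xia eta_a xc yc (agree (0 + 1) ltac:(clear; lia)).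
have g1 := edge_gain xia eta_a xc yc (agree (- 1 + 1) ltac:(clear; lia)).
rewrite -/(S _) -/(S _) in g0 g1.
move=> i i01.
have e0 := mulr_ge0 (ltW delta0) (dotp_ge0 (dir (y 0) (y (0 + 1)) - dir (x 0) (x (0 + 1)))).
have e1 := mulr_ge0 (ltW delta0) (dotp_ge0 (dir (y (- 1)) (y (- 1 + 1)) - dir (x (- 1)) (x (- 1 + 1)))).
rewrite addNr in g1 e1 *; rewrite add0r in g0 e0 *.
rewrite -(ler_pM2l delta0).
have [->|->] : i = 0 \/ i = - 1 by move: i01; clear; lia.
  by rewrite add0r; move: left_ right g0 g1 e0 e1; rewrite /kappa /S add0r addNr; lra.
by rewrite addNr; move: left_ right g0 g1 e0 e1; rewrite /kappa /S add0r addNr; lra.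
Qed.

End CriticalOrbits.

(** * Compactness estimates *)

Section Compactness.
Variable (R : realType).

(** The image is compact, hence closed, and misses 0, so it misses a ball around 0. No minimum has
    to be attained, so an empty [A] is covered. *)
Lemma compact_pos_lb (T : topologicalType) (A : set T) (f : T -> R) :
  compact A -> {in A, continuous f} -> (forall x, A x -> 0 < f x) ->
  exists2 eta : R, 0 < eta & forall x, A x -> eta <= f x.
Proof.
move=> cA cf fpos.
have cfA : closed (f @` A).
  apply: compact_closed; first exact: Rhausdorff.
  by apply: continuous_compact => //; exact: continuous_in_subspaceT.
have : nbhs (0 : R) (~` (f @` A)).
  apply: open_nbhs_nbhs; split; first exact: closed_openC.
  by move=> [x Ax fx0]; have := fpos x Ax; rewrite fx0 ltxx.
move=> /nbhs_ballP[r /= r0 hr]; exists r => // x Ax.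
rewrite leNgt; apply/negP => fxr; apply: (hr (f x)); last by exists x.
by rewrite /ball /= sub0r normrN gtr0_norm ?fpos.
Qed.

(** Turns constants found for each obstacle, or tuple of obstacles, into a single one. The minimum
    starts from 1, which also handles an empty index type. *)
Lemma finite_uniform_pos (T : finType) (P : T -> R -> Prop) :
  (forall t a b, a <= b -> P t b -> P t a) ->
  (forall t, exists2 eta, 0 < eta & P t eta) ->
  exists2 eta, 0 < eta & forall t, P t eta.
Proof.
move=> mono ex.
have /choice[h hh] : forall t, exists eta, 0 < eta /\ P t eta.
  by move=> t; have [x ? ?] := ex t; exists x.
exists (\big[Num.min/1]_t h t).
  by elim/big_ind: _ => // [x y x0 y0|i _]; [rewrite lt_min x0 y0|have [] := hh i].
by move=> t; apply: mono (hh t).2; apply: bigmin_le.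
Qed.

End Compactness.

(** * Uniform geometry of the obstacles and closeness of critical orbits *)

Section OpenBilliard.
Variables (R : realType) (N s : nat) (K : 'I_s -> set 'rV[R]_N).
Hypothesis billiard : open_billiard K.

Let Kcompact i : compact (K i). Proof. by case: billiard => [[_]]. Qed.
Let Kconvex i : is_convex (K i). Proof. by case: billiard. Qed.
Let Kstrict i : strictly_convex_set (K i). Proof. by case: billiard => _ _ []. Qed.

Lemma billiard_neq i j a b : i != j -> K i a -> K j b -> a != b.
Proof.
case: billiard => _ _ _ dis _ ij Ka Kb; apply/eqP => ab.
suff : (K i `&` K j) a by rewrite dis.
by split; rewrite // ab.
Qed.

Lemma billiard_separated : exists2 delta : R, 0 < delta &
  forall i j a b, i != j -> K i a -> K j b -> delta <= enorm (b - a).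
Proof.
have [|[i j]|delta d0 h] := @finite_uniform_pos R ('I_s * 'I_s)%type
  (fun ij delta => ij.1 != ij.2 -> forall a b, K ij.1 a -> K ij.2 b -> delta <= enorm (b - a)).
- move=> [i j] a b ab h ij p q Kp Kq; apply: le_trans ab (h ij _ _ Kp Kq).
- have [<-|ij] := eqVneq i j; first by exists 1 => //=; rewrite eqxx.
  have [|z _|[a b] [/= Ka Kb]|eta e0 h] := @compact_pos_lb R _ (K i `*` K j)
     (fun z => enorm (z.2 - z.1)).
  + exact: compact_setX.
  + by apply: cvg_enorm; apply: cvgB;
      [exact: cvg_snd|exact: cvg_fst].
  + by rewrite enorm_gt0 subr_eq0 eq_sym (billiard_neq ij).
  + by exists eta => // _ a b Ka Kb; apply: (h (a, b)).
- by exists delta => // i j a b ij; apply: (h (i, j) ij).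
Qed.

(** An upper bound on the distance is a positive lower bound on [(1 + enorm (b - a))^-1], so the two
    preceding compactness lemmas apply. *)
Lemma billiard_diameter : exists2 D : R, 0 < D &
  forall i a b, K i a -> K i b -> enorm (b - a) <= D.
Proof.
have [|i|eta e0 h] := @finite_uniform_pos R 'I_s
  (fun i delta => forall a b, K i a -> K i b -> delta <= (1 + enorm (b - a))^-1).
- move=> i a b ab h p q Kp Kq; apply: le_trans ab (h _ _ Kp Kq).
- have pos (z : 'rV[R]_N * 'rV[R]_N) : 0 < 1 + enorm (z.2 - z.1).
    by rewrite ltr_pwDl // enorm_ge0.
  have [|z _|[a b] [/= Ka Kb]|eta e0 h] := @compact_pos_lb R _ (K i `*` K i)
     (fun z => (1 + enorm (z.2 - z.1))^-1).
  + exact: compact_setX.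
  + apply: cvgV; first by rewrite gt_eqF // pos.
    apply: cvgD; first exact: cvg_cst.
    by apply: cvg_enorm; apply: cvgB;
      [exact: cvg_snd|exact: cvg_fst].
  + by rewrite invr_gt0 (pos (a, b)).
  + by exists eta => // a b Ka Kb; apply: (h (a, b)).
- exists eta^-1; first by rewrite invr_gt0.
  move=> i a b Ka Kb; have := h i a b Ka Kb.
  rewrite -[X in X <= _]invrK lef_pV2 ?posrE ?invr_gt0 ?ltr_pwDl ?enorm_ge0 //; lra.
Qed.

(* Otherwise [p] would lie on the segment from [a] to [b], against the
   no-eclipse condition (or convexity, when [i = k]). *)
Lemma dir_neq i j k a p b : i != j -> j != k -> K i a -> K j p -> K k b ->
  dir a p - dir p b != 0.
Proof.
case: billiard => _ _ _ dis ecl ij jk Ka Kp Kb.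
rewrite subr_eq0; apply/eqP => E.
have ap := billiard_neq ij Ka Kp; have pb := billiard_neq jk Kp Kb.
have A0 : 0 < enorm (p - a) by rewrite enorm_gt0 subr_eq0 eq_sym.
have B0 : 0 < enorm (b - p) by rewrite enorm_gt0 subr_eq0 eq_sym.
have AB0 := addr_gt0 A0 B0.
pose t := enorm (p - a) / (enorm (p - a) + enorm (b - p)).
have t01 : 0 <= t <= 1.
  by rewrite /t divr_ge0 ?(ltW A0) ?(ltW AB0) //= ler_pdivrMr // mul1r lerDl ltW.
have pE : p = (1 - t) *: a + t *: b.
  apply/eqP; rewrite -subr_eq0; apply/eqP.
  have -> : p - ((1 - t) *: a + t *: b) = (p - a) - t *: ((b - p) + (p - a)).
    by apply/rowP => l; rewrite !mxE; ring.
  rewrite (dirE ap) (dirE pb) -E -scalerDl scalerA -scalerBl.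
  by rewrite (addrC (enorm (b - p))) /t divfK ?subrr ?scale0r // gt_eqF.
have [ik|ik] := eqVneq i k.
  suff : (K i `&` K j) p by rewrite dis.
  by split=> //; rewrite pE; apply: Kconvex => //; rewrite ik.
suff : (conv_hull (K i `|` K k) `&` K j) p by rewrite ecl // eq_sym.
split=> // C Cc sub; rewrite pE; apply: Cc => //; apply: sub; first by left.
by right.
Qed.

(** Two distinct minimizers of the functional [g] would have an interior midpoint, also minimizing;
    a small move along [- g] from there stays in [K j] and lowers the value. *)
Lemma strict_support_unique j (g x y : 'rV[R]_N) : K j x -> K j y -> g != 0 ->
  (forall z, K j z -> 0 <= dotp g (z - x)) ->
  (forall z, K j z -> 0 <= dotp g (z - y)) -> x = y.
Proof.
move=> Kx Ky g0 gx gy; apply/eqP; apply: contraT => xy.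
have := Kstrict Kx Ky xy (t := 1 / 2).
have -> : (0 < 1 / 2 :> R) && (1 / 2 < 1 :> R) by apply/andP; split; lra.
move=> /(_ isT); set m := _ + _ => /nbhs_ballP[r /= r0 hr].
have ng0 : 0 < `|g| by rewrite normr_gt0.
(* The displacement [tau *: g] has norm [r / 2], inside the ball of radius [r]. *)
pose tau := r / 2 / `|g|.
have tau0 : 0 < tau by rewrite !divr_gt0.
have Kz : K j (m - tau *: g).
  apply: hr; rewrite -ball_normE /= opprB addrC subrK normrZ gtr0_norm //.
  by rewrite /tau mulfVK ?gt_eqF //; lra.
have gg : 0 < tau * dotp g g by rewrite mulr_gt0 // lt0r dotp_eq0 g0 dotp_ge0.
by have := gx _ Kz; have := gy _ Kx; rewrite /m !dotpE; lra.
Qed.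

(** The jump of direction at an optimal vertex is a nonzero supporting functional, by [dir_neq], and
    hence determines the vertex. On the compact set of pairs of optimal vertices at distance at
    least [eps], the two jumps therefore never coincide, and their distance has a positive
    minimum. *)
Lemma critical_gap (eps : R) : 0 < eps -> exists2 eta : R, 0 < eta &
  forall i j k a x b a' y b', i != j -> j != k ->
    K i a -> K j x -> K k b -> K i a' -> K j y -> K k b' ->
    (forall z, K j z -> 0 <= dotp (dir a x - dir x b) (z - x)) ->
    (forall z, K j z -> 0 <= dotp (dir a' y - dir y b') (z - y)) ->
    eps <= `|y - x| ->
    eta <= dotp ((dir a' y - dir y b') - (dir a x - dir x b))
                ((dir a' y - dir y b') - (dir a x - dir x b)).
Proof.
move=> eps0.
have [|[[i j] k]|eta e0 h] := @finite_uniform_pos R ('I_s * 'I_s * 'I_s)%type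
  (fun ijk eta => forall a x b a' y b', ijk.1.1 != ijk.1.2 -> ijk.1.2 != ijk.2 ->
    K ijk.1.1 a -> K ijk.1.2 x -> K ijk.2 b -> K ijk.1.1 a' -> K ijk.1.2 y -> K ijk.2 b' ->
    (forall z, K ijk.1.2 z -> 0 <= dotp (dir a x - dir x b) (z - x)) ->
    (forall z, K ijk.1.2 z -> 0 <= dotp (dir a' y - dir y b') (z - y)) ->
    eps <= `|y - x| ->
    eta <= dotp ((dir a' y - dir y b') - (dir a x - dir x b))
                ((dir a' y - dir y b') - (dir a x - dir x b))).
- move=> [[i j] k] /= u v uv h a x b a' y b' ij jk Ka Kx Kb Ka' Ky Kb' fx fy exy.
  exact: le_trans uv (h _ _ _ _ _ _ ij jk Ka Kx Kb Ka' Ky Kb' fx fy exy).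
- have [<-|ij] := eqVneq i j; first by exists 1 => //= ? ? ? ? ? ?; rewrite eqxx.
  have [<-|jk] := eqVneq j k; first by exists 1 => //= ? ? ? ? ? ?; rewrite eqxx.
  (* Each configuration is recorded only by its vertex and its jump; optimality and separation then
     become the closed conditions [F1], [F2], [F3] on pairs. *)
  pose T := (fun z : 'rV[R]_N * 'rV[R]_N * 'rV[R]_N =>
    (z.1.2, dir z.1.1 z.1.2 - dir z.1.2 z.2)) @` (K i `*` K j `*` K k).
  have cT : compact T.
    apply: continuous_compact; last by do 2! apply: compact_setX => //.
    apply: continuous_in_subspaceT => -[[a x] b]; rewrite inE => -[[/= Ka Kx] Kb].
    have c1 : {for (a, x, b), continuous (fun z : 'rV[R]_N * 'rV[R]_N * 'rV[R]_N => z.1.1)}.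
      by apply: (continuous_comp (f := fst)); [exact: cvg_fst|exact: cvg_fst].
    have c2 : {for (a, x, b), continuous (fun z : 'rV[R]_N * 'rV[R]_N * 'rV[R]_N => z.1.2)}.
      by apply: (continuous_comp (f := fst)); [exact: cvg_fst|exact: cvg_snd].
    have c3 : {for (a, x, b), continuous (fun z : 'rV[R]_N * 'rV[R]_N * 'rV[R]_N => z.2)}.
      exact: cvg_snd.
    apply: (@cvg_pair _ _ _ (nbhs (a, x, b)) (nbhs x) (nbhs (dir a x - dir x b))) => //.
    apply: cvgB; apply: cvg_dir => //=.
      exact: billiard_neq ij Ka Kx.
    exact: billiard_neq jk Kx Kb.
  pose W := (('rV[R]_N * 'rV[R]_N) * ('rV[R]_N * 'rV[R]_N))%type.
  pose F1 : set W := \bigcap_(z in K j) [set w | 0 <= dotp w.1.2 (z - w.1.1)].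
  pose F2 : set W := \bigcap_(z in K j) [set w | 0 <= dotp w.2.2 (z - w.2.1)].
  pose F3 : set W := [set w | eps <= `|w.2.1 - w.1.1|].
  have c1 : continuous (fun w : W => w.1.1).
    by move=> w; apply: (continuous_comp (f := fst)); exact: cvg_fst.
  have c2 : continuous (fun w : W => w.1.2).
    by move=> w; apply: (continuous_comp (f := fst)); [exact: cvg_fst|exact: cvg_snd].
  have c3 : continuous (fun w : W => w.2.1).
    by move=> w; apply: (continuous_comp (f := snd)); [exact: cvg_snd|exact: cvg_fst].
  have c4 : continuous (fun w : W => w.2.2).
    by move=> w; apply: (continuous_comp (f := snd)); exact: cvg_snd.
  have cF1 : closed F1.
    apply: closed_bigI => z _.
    apply: (preimage_closed (f := fun w : W => dotp w.1.2 (z - w.1.1))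
      (D := [set r | 0 <= r])); last exact: closed_ge.
    move=> w _; apply: cvg_dotp; first exact: c2.
    by apply: cvgB; [exact: cvg_cst|exact: c1].
  have cF2 : closed F2.
    apply: closed_bigI => z _.
    apply: (preimage_closed (f := fun w : W => dotp w.2.2 (z - w.2.1))
      (D := [set r | 0 <= r])); last exact: closed_ge.
    move=> w _; apply: cvg_dotp; first exact: c4.
    by apply: cvgB; [exact: cvg_cst|exact: c3].
  have cF3 : closed F3.
    apply: (preimage_closed (f := fun w : W => `|w.2.1 - w.1.1|)
      (D := [set r | eps <= r])); last exact: closed_ge.
    by move=> w _; apply: cvg_norm; apply: cvgB; [exact: c3|exact: c1].
  have [|w _||eta e0 h] := @compact_pos_lb R _ ((T `*` T) `&` F1 `&` F2 `&` F3)
     (fun w => dotp (w.2.2 - w.1.2) (w.2.2 - w.1.2)).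
  + by do 3! apply: compact_closedI => //; exact: compact_setX.
  + by apply: cvg_dotp; apply: cvgB; [exact: c4|exact: c2|exact: c4|exact: c2].
  + move=> [[x g] [y g']] [[[[/= T1 T2] f1] f2] exy]; move: T1 T2 f1 f2 exy.
    move=> [[[a p] b] [[/= Ka Kp] Kb] [<- <-]] [[[a' p'] b'] [[/= Ka' Kp'] Kb'] [<- <-]].
    move=> f1 f2 exy; rewrite lt0r dotp_ge0 andbT dotp_eq0 subr_eq0.
    (* Equal jumps would support [K j] at both vertices, forcing these to coincide. *)
    apply/eqP => gg; move: exy; rewrite /F3 /=.
    have -> : p' = p.
      apply/esym; apply: (@strict_support_unique j _ _ _ Kp Kp' (dir_neq ij jk Ka Kp Kb)) => z Kz.
        exact: f1 z Kz.
      by have := f2 z Kz; rewrite /= gg.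
    by rewrite subrr normr0 leNgt eps0.
  + exists eta => //= a x b a' y b' _ _ Ka Kx Kb Ka' Ky Kb' fx fy exy.
    apply: (h ((x, dir a x - dir x b), (y, dir a' y - dir y b'))).
    split=> //; split; last exact: fy.
    by split; [split; [exists (a, x, b)|exists (a', y, b')]|exact: fx].
- exists eta => // i j k a x b a' y b'; exact: (h (i, j, k)).
Qed.

(** The jump at vertex 0 involves only edges -1 and 0, whose directions are close by [close_dirs].
    Vertices [eps] apart would violate [critical_gap]. *)
Lemma critical_close (eps : R) : 0 < eps -> exists m : nat,
  forall xi eta x y, admissible xi -> admissible eta ->
    critical K xi x -> critical K eta y ->
    (forall i : int, `|i| <= m%:Z -> xi i = eta i) -> `|y 0 - x 0| < eps.
Proof.
move=> eps0; have [gap gap0 hgap] := critical_gap eps0.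
have [delta d0 sep] := billiard_separated.
have [D D0 diam] := billiard_diameter.
(* With both edge differences at most [gap / 8] in squared norm, the jumps differ by at most
   [gap / 2] in squared norm. *)
have g80 : 0 < gap / 8 by lra.
have [m hm] := close_dirs d0 D0 sep diam g80.
(* The successor guarantees agreement at -1, 0 and 1 even when [m = 0]. *)
exists m.+1 => xi eta x y axi aeta cx cy agree.
have E i : - 1 <= i <= 1 -> xi i = eta i by move=> i1; apply: agree; move: i1; clear; lia.
have agree' i : `|i| <= m%:Z -> xi i = eta i by move=> im; apply: agree; move: im; clear; lia.
have h := hm _ _ _ _ axi aeta cx cy agree'.
have h1 := h (- 1) isT; have h0 := h 0 isT; rewrite addNr add0r in h1 h0.
rewrite ltNge; apply/negP => exy.
have [Kx fx] := cx 0; have [Ky fy] := cy 0.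
have [Ka _] := cx (- 1); have [Ka' _] := cy (- 1).
have [Kb _] := cx 1; have [Kb' _] := cy 1.
have a1 := axi (- 1); have a0 := axi 0; rewrite addNr add0r in a1 a0.
rewrite sub0r add0r in fx fy.
rewrite -!E // in Ky Ka' Kb' fy.
have := hgap _ _ _ _ _ _ _ _ _ a1 a0 Ka Kx Kb Ka' Ky Kb' fx fy exy.
set u := dir (y (- 1)) _ in h1 *; set v := dir (y 0) _ in h0 *.
set u' := dir (x (- 1)) _ in h1 *; set v' := dir (x 0) _ in h0 *.
have := dotp_ge0 ((u - u') + (v - v')).
have -> : u - v - (u' - v') = (u - u') - (v - v') by apply/rowP => l; rewrite !mxE; ring.
move: h1 h0; move: (u - u') (v - v') => e e'; rewrite !dotpE (dotpC e' e); lra.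
Qed.

End OpenBilliard.

(** * The reflection law as first-order optimality *)

Section PartialDerivatives.
Variables (R : realType) (N : nat).
Implicit Types (f : 'rV[R]_N -> R) (p q d : 'rV[R]_N).

(** The mean value theorem on a coordinate line, for either sign of [c] since components of a
    direction may be negative. *)
Lemma coordinate_MVT f q i (c L eps : R) :
  (forall r : R, `|r| <= `|c| -> derivable f (q + r *: ebasis R i) (ebasis R i) /\
    `|pder f i (q + r *: ebasis R i) - L| <= eps) ->
  f (q + c *: ebasis R i) - f q <= c * L + `|c| * eps.
Proof.
move=> h.
pose g (r : R) := f (q + r *: ebasis R i).
(* The difference quotients of [g] are those of [f] along the basis vector, so derivability and
   derivative transfer. *)
have quot r : (fun h0 : R => h0^-1 *: (g (h0 *: 1 + r) - g r)) =
    (fun h0 : R => h0^-1 *: (f (h0 *: ebasis R i + (q + r *: ebasis R i)) - f (q + r *: ebasis R i))).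
  apply: funext => h0; rewrite /g; congr (_ *: (f _ - _)).
  by rewrite scalerDl addrCA [h0 *: 1]mulr1.
have g' (r : R) : `|r| <= `|c| -> is_derive r (1 : R) g (pder f i (q + r *: ebasis R i)).
  move=> rc; have [df _] := h r rc; apply: DeriveDef.
    by rewrite /derivable quot.
  by rewrite /pder /derive quot.
have mvt (a b : R) : a < b -> `|a| <= `|c| -> `|b| <= `|c| ->
    exists2 r, `|r| <= `|c| & g b - g a = pder f i (q + r *: ebasis R i) * (b - a).
  move=> ab ac bc.
  have inside r : a <= r <= b -> `|r| <= `|c|.
    by move: ac bc; rewrite !ler_norml => /andP[? ?] /andP[? ?] /andP[? ?]; apply/andP; split; lra.
  have [||r rab ->] := @MVT R g (fun r => pder f i (q + r *: ebasis R i)) a b ab.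
  - by move=> r; rewrite in_itv /= => /andP[? ?]; apply/g'/inside/andP; split; exact: ltW.
  - apply: derivable_within_continuous => r; rewrite in_itv /= => rab.
    by have [] := g' r (inside _ rab).
  - exists r => //; apply: inside; move: rab; rewrite in_itv /= => /andP[? ?].
    by apply/andP; split; exact: ltW.
have g0 : g 0 = f q by rewrite /g scale0r addr0.
rewrite -g0 -/(g c).
have [c0|c0|->] := ltrgt0P c; last by rewrite subrr !mul0r addr0.
- have z0 : `|0 : R| <= `|c| by rewrite normr0.
  have [r rc ->] := mvt 0 c c0 z0 (lexx _).
  have [_] := h r rc; rewrite ler_norml subr0 => /andP[_ hr]; move: hr; move: (pder _ _ _) => D hr.
  by rewrite mulrC -mulrDr ler_pM2l //; lra.
- have z0 : `|0 : R| <= `|c| by rewrite normr0.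
  have [r rc E] := mvt c 0 c0 (lexx _) z0.
  have [_] := h r rc; rewrite ler_norml => /andP[hr _]; move: hr E; move: (pder _ _ _) => D hr E.
  have -> : g c - g 0 = D * c by rewrite -opprB E sub0r mulrN opprK.
  have : 0 <= - c * (D - L + eps) by rewrite mulr_ge0 //; lra.
  lra.
Qed.

(** The displacement is made one coordinate at a time, with [coordinate_MVT] at each stage; the
    smallness condition keeps every intermediate point within [rho] of [p]. Continuous partial
    derivatives thus suffice for a first-order bound. *)
Lemma directional_ub f p d (rho eps tau : R) :
  (forall x, `|x - p| < rho -> forall i, derivable f x (ebasis R i) /\
    `|pder f i x - pder f i p| <= eps) ->
  0 < tau -> forall r : seq 'I_N,
  tau * (\sum_(i <- r) `|d ord0 i| * `|ebasis R i|) < rho ->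
  f (p + tau *: \sum_(i <- r) d ord0 i *: ebasis R i) - f p <=
  tau * \sum_(i <- r) (d ord0 i * pder f i p + `|d ord0 i| * eps).
Proof.
move=> h tau0; elim=> [|i r IH]; first by rewrite !big_nil scaler0 addr0 subrr mulr0.
rewrite !big_cons => small.
set q := p + tau *: \sum_(j <- r) d ord0 j *: ebasis R j.
have sum0 : 0 <= \sum_(j <- r) `|d ord0 j| * `|ebasis R j|.
  by apply: sumr_ge0 => j _; rewrite mulr_ge0.
have di0 : 0 <= `|d ord0 i| * `|ebasis R i| by rewrite mulr_ge0.
have small' : tau * (\sum_(j <- r) `|d ord0 j| * `|ebasis R j|) < rho.
  by apply: le_lt_trans small; rewrite ler_pM2l //; lra.
have sum_le : `|\sum_(j <- r) d ord0 j *: ebasis R j| <= \sum_(j <- r) `|d ord0 j| * `|ebasis R j|.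
  by apply: le_trans (ler_norm_sum _ _ _) _; apply: ler_sum => j _; rewrite normrZ.
have -> : p + tau *: (d ord0 i *: ebasis R i + \sum_(j <- r) d ord0 j *: ebasis R j) =
    q + (tau * d ord0 i) *: ebasis R i.
  by rewrite /q scalerDr scalerA addrA addrAC.
have := @coordinate_MVT f q i (tau * d ord0 i) (pder f i p) eps.
have near_p s : `|s| <= `|tau * d ord0 i| -> `|q + s *: ebasis R i - p| < rho.
  move=> sc; apply: le_lt_trans small; rewrite /q addrAC [_ - p]addrC addKr.
  apply: le_trans (ler_normD _ _) _; rewrite !normrZ (gtr0_norm tau0) addrC mulrDr lerD //.
    by rewrite mulrA ler_wpM2r //; move: sc; rewrite normrM (gtr0_norm tau0).
  by rewrite ler_pM2l.
move=> /(_ (fun s sc => h _ (near_p s sc) i)).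
rewrite normrM (gtr0_norm tau0).
have := IH small'; rewrite -/q; move: (\sum_(_ <- _) _) => S; lra.
Qed.

Lemma directional_decrease (U : set 'rV[R]_N) f p d : open U -> U p -> C2_on U f ->
  \sum_i d ord0 i * pder f i p < 0 ->
  exists2 tau0 : R, 0 < tau0 & forall tau, 0 < tau < tau0 -> f (p + tau *: d) <= f p.
Proof.
move=> oU Up fC2; set a := \sum_i _ => a0.
pose M := \sum_i `|d ord0 i|.
have M0 : 0 <= M by apply: sumr_ge0.
(* The accumulated error [M * eps] stays below [- a]; the added 1 avoids dividing by zero. *)
pose eps := - a / (M + 1).
have eps0 : 0 < eps by rewrite divr_gt0 ?oppr_gt0 // ltr_wpDl.
have [rho rho0 hrho] : exists2 rho : R, 0 < rho &
    forall x, `|x - p| < rho -> forall i, derivable f x (ebasis R i) /\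
      `|pder f i x - pder f i p| <= eps.
  have [_ _ cont _ _] := fC2 p Up.
  have near_grad : \forall x \near p, forall i, `|pder f i p - pder f i x| < eps.
    suff h i : nbhs p [set x | `|pder f i p - pder f i x| < eps].
      exact: (@filter_forall _ _ (fun i => [set x | `|pder f i p - pder f i x| < eps]) (nbhs p) _ h).
    by have /cvgrPdist_lt/(_ _ eps0) := cont i.
  have : nbhs p (U `&` [set x | forall i, `|pder f i p - pder f i x| < eps]).
    by apply: filterI => //; exact: open_nbhs_nbhs.
  move=> /nbhs_ballP[rho /= rho0 hrho]; exists rho => // x xp i.
  have [|Ux hx] := hrho x; first by rewrite -ball_normE /= distrC.
  split.
    by have [_ df _ _ _] := fC2 x Ux.
  by rewrite distrC ltW.
pose B := \sum_i `|d ord0 i| * `|ebasis R i|.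
have B0 : 0 <= B by apply: sumr_ge0 => i _; rewrite mulr_ge0.
exists (rho / (B + 1)); first by rewrite divr_gt0 // ltr_wpDl.
move=> tau /andP[tau0 taulim].
have small : tau * B < rho.
  move: taulim; rewrite ltr_pdivlMr ?ltr_wpDl // mulrDr mulr1; lra.
have := directional_ub (d := d) hrho tau0 small.
have -> : \sum_i d ord0 i *: ebasis R i = d by rewrite [RHS]row_sum_delta.
rewrite big_split /= -mulr_suml -/a -/M => hle.
rewrite -subr_le0; apply: le_trans hle _; rewrite pmulr_rle0 //.
have : M * eps <= - a.
  by rewrite /eps mulrCA -[leRHS]mulr1 ler_pM2l ?oppr_gt0 // ler_pdivrMr ?mul1r ?lerDl // ltr_wpDl.
lra.
Qed.

(* If [n] is normal to [A] at [p] then [n] is a positive multiple of the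
   gradient of [F]: every descent direction of [F] points into [A]. *)
Lemma inward_direction (A : set 'rV[R]_N) p n d : C2_boundary A -> A p -> ~ A° p ->
  outer_unit_normal A p n -> dotp d n < 0 ->
  exists2 tau0 : R, 0 < tau0 & forall tau, 0 < tau < tau0 -> A (p + tau *: d).
Proof.
move=> smooth Ap nAp [n1 nA] dn.
have [U [F [oU Up FC2 [i0 Fi0] AF]]] := smooth p (conj (subset_closure Ap) nAp).
pose g : 'rV[R]_N := \row_i pder F i p.
have gE d' : \sum_i d' ord0 i * pder F i p = dotp d' g.
  by apply: eq_bigr => i _; rewrite mxE.
have g0 : 0 < dotp g g.
  rewrite lt0r dotp_ge0 andbT dotp_eq0; apply: contra Fi0 => /eqP/rowP/(_ i0).
  by rewrite !mxE => ->.
have descent d' : dotp d' g < 0 ->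
    exists2 tau0 : R, 0 < tau0 & forall tau, 0 < tau < tau0 -> A (p + tau *: d').
  rewrite -gE => d'0.
  have [tau1 tau10 h1] := directional_decrease oU Up FC2 d'0.
  have : \forall tau \near (0 : R), U (p + tau *: d').
    have : (fun tau : R => p + tau *: d') @ (0 : R) --> p + 0 *: d'.
      by apply: cvgD; [exact: cvg_cst|apply: cvgZl; exact: cvg_id].
    rewrite scale0r addr0 => cv; apply: cv.
    exact: open_nbhs_nbhs.
  move=> /nbhs_ballP[tau2 /= tau20 h2].
  exists (Num.min tau1 tau2); first by rewrite lt_min tau10 tau20.
  move=> tau /andP[tau0]; rewrite lt_min => /andP[t1 t2].
  apply/AF; first by apply: h2; rewrite /ball /= sub0r normrN gtr0_norm.
  by apply: le_trans (h1 tau _) _; [rewrite tau0|apply/(AF p Up)].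
(* If [d] were not a descent direction, [- d - mu *: g] would be one. It would point into [A],
   although for small [mu] it has a positive component along the outer normal [n]. *)
apply: (descent d); rewrite ltNge; apply/negP => dg.
(* Small enough that [mu * dotp g n] is at most half of [- dotp d n]. *)
pose mu := - dotp d n / (`|dotp g n| + 1) / 2.
have den0 : 0 < `|dotp g n| + 1 by rewrite ltr_wpDl.
have mu0 : 0 < mu by rewrite !divr_gt0 ?oppr_gt0.
have [|tau0 tau00 h] := descent (- d - mu *: g).
  by rewrite !dotpE; have := mulr_gt0 mu0 g0; lra.
have := nA _ (h (tau0 / 2) _); rewrite divr_gt0 //= => /(_ _)/wrap[]; first lra.
rewrite addrC addKr dotpZl pmulr_rle0 ?divr_gt0 // !dotpE.
have : mu * dotp g n <= - dotp d n / 2.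
  rewrite /mu mulrAC ler_pM2r // -mulrA -[leRHS]mulr1 ler_pM2l ?oppr_gt0 //.
  rewrite mulrC ler_pdivrMr // mul1r; apply: le_trans (ler_norm _) _; lra.
lra.
Qed.

End PartialDerivatives.

(** By the reflection law the jump is [2 * dotp u n] times [n], where [u] is the incoming direction,
    and [dotp n (z - x i) <= 0] on the obstacle. It remains that [dotp u n <= 0]: otherwise the
    reversed incoming segment would enter the obstacle, against its being free. *)
Lemma billiard_orbit_critical (R : realType) (N s : nat) (K : 'I_s -> set 'rV[R]_N)
    (xi : int -> 'I_s) (x : int -> 'rV[R]_N) :
  open_billiard K -> admissible xi -> billiard_orbit K xi x -> critical K xi x.
Proof.
move=> hK axi ox i; have [Kx nKx free [n [[n1 nA] wE]]] := ox i; split=> // z Kz.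
have [Ka _ free' _] := ox (i - 1); rewrite subrK in free'.
have ax : x (i - 1) != x i.
  have ij : xi (i - 1) != xi i by have := axi (i - 1); rewrite subrK.
  exact: (billiard_neq hK ij Ka Kx).
have smooth : C2_boundary (K (xi i)) by case: hK => _ _ [_ h] _ _; exact: h.
rewrite -/(dir _ _) in wE; rewrite -[X in X = _]/(dir _ _) in wE.
rewrite [dir (x i) _]wE opprB addrC subrK dotpZl.
have un : dotp (dir (x (i - 1)) (x i)) n <= 0.
  rewrite leNgt; apply/negP => un.
  set X := enorm (x i - x (i - 1)).
  have X0 : 0 < X by rewrite enorm_gt0 subr_eq0 eq_sym.
  have [|tau0 tau00 h] := inward_direction (d := x (i - 1) - x i) smooth Kx nKx (conj n1 nA).
    by rewrite -opprB (dirE ax) dotpNl dotpZl oppr_lt0 mulr_gt0.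
  (* Below [tau0] to land in the obstacle, and at most [1 / 2] to stay inside the open segment. *)
  pose tau := Num.min (tau0 / 2) (1 / 2).
  have t1 : 0 < tau by rewrite lt_min !divr_gt0.
  have t2 : tau <= tau0 / 2 by rewrite ge_min lexx.
  have t3 : tau <= 1 / 2 by rewrite ge_min lexx orbT.
  apply: (free' (1 - tau)); first by apply/andP; split; lra.
  exists (xi i) => //.
  have -> : (1 - (1 - tau)) *: x (i - 1) + (1 - tau) *: x i = x i + tau *: (x (i - 1) - x i).
    by apply/rowP => l; rewrite !mxE; ring.
  by apply: h; rewrite t1 /=; lra.
have zn := nA z Kz; rewrite dotpC in zn.
have := mulr_le0 un zn; move: (dotp _ _) (dotp _ _) => u v; lra.
Qed.

Lemma observable_close (R : realType) (N s : nat) (K : 'I_s -> set 'rV[R]_N)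
    (phi : (int -> 'I_s) -> 'rV[R]_N) :
  open_billiard K -> is_coding_observable K phi ->
  forall eps : R, 0 < eps -> exists m : nat, forall xi eta,
    admissible xi -> admissible eta ->
    (forall i : int, `|i| <= m%:Z -> xi i = eta i) -> `|phi xi - phi eta| < eps.
Proof.
move=> hK hphi eps eps0; have [m hm] := critical_close hK eps0.
exists m => xi eta axi aeta agree.
have [x [ox <-]] := hphi xi axi; have [y [oy <-]] := hphi eta aeta.
have cx := billiard_orbit_critical hK axi ox; have cy := billiard_orbit_critical hK aeta oy.
by rewrite distrC; exact: (hm _ _ _ _ axi aeta cx cy agree).
Qed.

Lemma observable_bounded (R : realType) (N s : nat) (K : 'I_s -> set 'rV[R]_N)
    (phi : (int -> 'I_s) -> 'rV[R]_N) :
  open_billiard K -> is_coding_observable K phi ->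
  exists2 B : R, 0 < B & forall xi, admissible xi -> `|phi xi| <= B.
Proof.
move=> hK hphi.
(* Writing the bound as [|x| * b <= 1] makes it pass to smaller [b], as [finite_uniform_pos]
   requires; the common constant is then inverted. *)
have [|i|eta e0 h] := @finite_uniform_pos R 'I_s
  (fun i b => forall x, K i x -> `|x| * b <= 1).
- by move=> i a b ab h x Kx; apply: le_trans (h _ Kx); rewrite ler_wpM2l.
- have cK : compact (K i) by case: hK => [[_]].
  have [M [_ hM]] := compact_bounded cK.
  have M0 : 0 < `|M| + 1 by rewrite ltr_wpDl.
  exists (`|M| + 1)^-1; first by rewrite invr_gt0.
  move=> x Kx; rewrite ler_pdivrMr // mul1r; apply: hM => //.
  by rewrite (le_lt_trans (ler_norm _)) // ltrDl.
exists eta^-1; first by rewrite invr_gt0.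
move=> xi axi; have [x [ox <-]] := hphi xi axi; have [Kx _ _ _] := ox 0.
by rewrite -[eta^-1]mul1r ler_pdivlMr //; exact: h Kx.
Qed.

(** * Rotation sets over the symbol space *)

Section Symbolic.
Variable s : nat.
Implicit Types (xi eta zeta : int -> 'I_s).
Local Notation sigma := (@Defs.shift s).

Lemma iter_shiftE (n : nat) xi (i : int) : iter n sigma xi i = xi (i + n%:Z).
Proof.
elim: n i => [|n IH] i /=; first by rewrite addr0.
by rewrite /Defs.shift IH; congr (xi _); clear; lia.
Qed.

Lemma admissible_iter (n : nat) xi : admissible xi -> admissible (iter n sigma xi).
Proof.
move=> axi i; rewrite !iter_shiftE.
have -> : i + 1 + n%:Z = i + n%:Z + 1 by clear; lia.
exact: axi.
Qed.

(** * Joining and closing words with one extra symbol *)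

Hypothesis s3 : (3 <= s)%N.

Lemma third_symbol (a b : 'I_s) : exists c : 'I_s, c != a /\ c != b.
Proof.
have [/existsP[c /andP[ca cb]]|/existsPn h] := boolP [exists c : 'I_s, (c != a) && (c != b)].
  by exists c.
suff : (s <= 2)%N by rewrite leqNgt s3.
rewrite -(size_enum_ord s).
apply: (@uniq_leq_size _ (enum 'I_s) [:: a; b] (enum_uniq _)) => c _; rewrite !inE.
by have := h c; rewrite negb_and !negbK.
Qed.

(** Position [n] carries a symbol different from both neighbours [xi (n - 1)] and [eta 0]; this is
    where three symbols are needed. *)
Lemma glue_exists xi eta (n : int) : admissible xi -> admissible eta ->
  exists zeta, [/\ admissible zeta, forall i, i < n -> zeta i = xi i &
    forall i, 0 <= i -> zeta (n + 1 + i) = eta i].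
Proof.
move=> axi aeta; have [c [c1 c2]] := third_symbol (xi (n - 1)) (eta 0).
exists (fun i => if i < n then xi i else if i == n then c else eta (i - n - 1)).
split=> [i|i -> //|i i0]; last first.
  rewrite ifF; last by move: i0; clear; lia.
  by rewrite ifF; [congr (eta _); clear; lia|move: i0; clear; lia].
have [lt1|lt1] := ltP i n; have [lt2|lt2] := ltP (i + 1) n.
- exact: axi.
- rewrite ifT; last by move: lt1 lt2; clear; lia.
  by rewrite eq_sym; have -> : i = n - 1 by move: lt1 lt2; clear; lia.
- by exfalso; move: lt1 lt2; clear; lia.
- rewrite [i + 1 == n]negbTE; last by move: lt1; clear; lia.
  have [->|ni] := eqVneq i n.
    by have -> : n + 1 - n - 1 = 0 by clear; lia.
  have -> : i + 1 - n - 1 = i - n - 1 + 1 by clear; lia.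
  exact: aeta.
Qed.

(** The period is [n.+1]: the word of length [n] and then one symbol compatible with its last and
    first letters, so that the wrap-around is admissible. *)
Lemma periodize_exists xi (n : nat) : admissible xi -> (0 < n)%N ->
  exists zeta, [/\ admissible zeta, iter n.+1 sigma zeta = zeta &
    forall i : int, 0 <= i < n%:Z -> zeta i = xi i].
Proof.
move=> axi n0; have [c [c1 c2]] := third_symbol (xi (n%:Z - 1)) (xi 0).
pose r (i : int) := (i %% n.+1%:Z)%Z.
have r_bound i : 0 <= r i < n.+1%:Z.
  by rewrite /r modz_ge0 //= ltz_pmod.
have rS i : r (i + 1) = if r i == n%:Z then 0 else r i + 1.
  have E : r (i + 1) = r (r i + 1) by rewrite /r modzDml.
  rewrite E; have := r_bound i; case: eqP => [-> _|rn rb].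
    have -> : n%:Z + 1 = n.+1%:Z by clear; lia.
    by rewrite /r modzz.
  by rewrite {1}/r modz_small //; move: rn rb; clear; lia.
exists (fun i => if r i == n%:Z then c else xi (r i)); split.
- move=> i; rewrite rS.
  have [_|rn] := eqVneq (r i) n%:Z.
    by rewrite ifF //; move: n0; clear; lia.
  have [E|_] := eqVneq (r i + 1) n%:Z; last exact: axi.
  have -> : r i = n%:Z - 1 by move: E; clear; lia.
  by rewrite eq_sym.
- apply: funext => i; rewrite iter_shiftE.
  by have -> : r (i + n.+1%:Z) = r i by rewrite /r modzDr.
- move=> i ib; have -> : r i = i by rewrite /r modz_small //; move: ib; clear; lia.
  by rewrite ifF //; move: ib; clear; lia.
Qed.

(** * Birkhoff sums and the vectors they approximate *)

Variables (R : realType) (N : nat) (phi : (int -> 'I_s) -> 'rV[R]_N) (B : R).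
Hypothesis phi_close : forall eps : R, 0 < eps -> exists m : nat, forall xi eta,
  admissible xi -> admissible eta ->
  (forall i : int, `|i| <= m%:Z -> xi i = eta i) -> `|phi xi - phi eta| < eps.
Hypothesis B0 : 0 < B.
Hypothesis phi_bounded : forall xi, admissible xi -> `|phi xi| <= B.

Definition birkhoff_sum xi n := \sum_(i < n) phi (iter i sigma xi).

Lemma birkhoff_sumD xi a n :
  birkhoff_sum xi (a + n) = birkhoff_sum xi a + birkhoff_sum (iter a sigma xi) n.
Proof.
rewrite /birkhoff_sum big_split_ord /=; congr (_ + _).
by apply: eq_bigr => i _; rewrite addnC iterD.
Qed.

Lemma norm_birkhoff_sum xi n : admissible xi -> `|birkhoff_sum xi n| <= n%:R * B.
Proof.
move=> axi; apply: le_trans (ler_norm_sum _ _ _) _.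
rewrite mulr_natl -[X in _ *+ X]card_ord -sumr_const.
by apply: ler_sum => i _; apply/phi_bounded/admissible_iter.
Qed.

Lemma norm_birkhoff_sumB xi zeta n : admissible xi -> admissible zeta ->
  `|birkhoff_sum xi n - birkhoff_sum zeta n| <= n%:R * (2 * B).
Proof.
move=> axi azeta; apply: le_trans (ler_normB _ _) _.
have := norm_birkhoff_sum n axi; have := norm_birkhoff_sum n azeta; lra.
Qed.

(** Agreement on the word alone controls the terms at distance at least [m] from its ends, by
    uniform continuity. The [m] terms at either end cost at most [2 * B] each, a constant
    independent of [n]. *)
Lemma birkhoff_sum_close (eps : R) : 0 < eps -> exists2 C, 0 <= C &
  forall xi zeta n, admissible xi -> admissible zeta ->
    (forall i : int, 0 <= i < n%:Z -> xi i = zeta i) ->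
    `|birkhoff_sum xi n - birkhoff_sum zeta n| <= eps * n%:R + C.
Proof.
move=> eps0; have [m hm] := phi_close eps0.
have mB : 0 <= m%:R * (2 * B) by rewrite !mulr_ge0 // ltW.
exists (2 * (m%:R * (2 * B))) => [|xi zeta n axi azeta agree]; first by lra.
have [n2|n2] := leqP n (m + m).
  apply: le_trans (norm_birkhoff_sumB n axi azeta) _.
  have : n%:R * (2 * B) <= (m%:R + m%:R) * (2 * B).
    by rewrite ler_wpM2r ?mulr_ge0 ?(ltW B0) // -natrD ler_nat.
  have : 0 <= eps * n%:R by rewrite mulr_ge0 // ltW.
  lra.
have [n' nE] : exists n', n = (m + (n' + m))%N.
  by exists (n - m - m)%N; move: n2; clear; lia.
rewrite nE !birkhoff_sumD.
set xi1 := iter m _ xi; set zeta1 := iter m _ zeta.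
have b1 := norm_birkhoff_sumB m axi azeta.
have b3 := norm_birkhoff_sumB m (admissible_iter n' (admissible_iter m axi))
  (admissible_iter n' (admissible_iter m azeta)).
rewrite -/xi1 -/zeta1 in b3.
have b2 : `|birkhoff_sum xi1 n' - birkhoff_sum zeta1 n'| <= eps * n'%:R.
  rewrite /birkhoff_sum -sumrB; apply: le_trans (ler_norm_sum _ _ _) _.
  rewrite mulr_natr -[X in _ *+ X]card_ord -sumr_const.
  apply: ler_sum => i _; apply/ltW/hm.
  - exact/admissible_iter/admissible_iter.
  - exact/admissible_iter/admissible_iter.
  - move=> j jm; rewrite /xi1 /zeta1 !iter_shiftE; apply: agree.
    by rewrite nE; move: (ltn_ord i) jm; clear; lia.
have e' : eps * n'%:R <= eps * (m + (n' + m))%:R.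
  by rewrite ler_pM2l // ler_nat; clear; lia.
rewrite opprD addrACA; apply: le_trans (ler_normD _ _) _.
rewrite [X in _ + X](_ : _ = `|(birkhoff_sum xi1 n' - birkhoff_sum zeta1 n') +
  (birkhoff_sum (iter n' sigma xi1) m - birkhoff_sum (iter n' sigma zeta1) m)|); last first.
  by rewrite opprD addrACA.
have := ler_normD (birkhoff_sum xi1 n' - birkhoff_sum zeta1 n')
  (birkhoff_sum (iter n' sigma xi1) m - birkhoff_sum (iter n' sigma zeta1) m).
lra.
Qed.

(* The finite-orbit description of the rotation set: closed under convex
   combinations because words can be concatenated up to one extra symbol. *)
Definition approachable v := forall (eps : R) (L : nat), 0 < eps ->
  exists xi n, [/\ admissible xi, (L <= n)%N &
    `|birkhoff_sum xi n - n%:R *: v| <= eps * n%:R].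

Lemma dist_birkhoff_avg xi n v :
  `|birkhoff_avg phi xi n.+1 - v| = `|birkhoff_sum xi n.+1 - n.+1%:R *: v| / n.+1%:R.
Proof.
have n0 : n.+1%:R != 0 :> R by rewrite pnatr_eq0.
rewrite /birkhoff_avg -/(birkhoff_sum _ _).
have -> : n.+1%:R^-1 *: birkhoff_sum xi n.+1 - v =
    n.+1%:R^-1 *: (birkhoff_sum xi n.+1 - n.+1%:R *: v).
  by rewrite scalerBr scalerA mulVf // scale1r.
by rewrite normrZ normfV ger0_norm // mulrC.
Qed.

Lemma gen_rotation_approachable v : gen_rotation_set phi v -> approachable v.
Proof.
move=> [xi [axi [nk [nk_incr cv]]]] eps L eps0.
have nk_ge k : (k <= nk k)%N.
  by elim: k => // k IH; apply: leq_ltn_trans IH (nk_incr k).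
move/cvgrPdist_le: cv => /(_ _ eps0)[k0 _ hk].
exists xi, (nk (maxn k0 L)).+1; split=> //.
  by apply: leqW; apply: leq_trans (nk_ge _); rewrite leq_maxr.
have := hk (maxn k0 L) (leq_maxl _ _).
by rewrite distrC dist_birkhoff_avg ler_pdivrMr ?ltr0n.
Qed.

Lemma bounded_rotation_vector xi v C :
  (forall n, `|birkhoff_sum xi n - n%:R *: v| <= C) -> is_rotation_vector phi xi v.
Proof.
move=> h; apply/cvgrPdist_le => eps eps0.
exists (Num.truncn (C / eps)) => // n /= hn.
rewrite distrC dist_birkhoff_avg ler_pdivrMr ?ltr0n //.
apply: le_trans (h _) _; rewrite mulrC -ler_pdivrMr //.
apply/ltW/(lt_le_trans (truncnS_gt _)).
by rewrite ler_nat ltnS.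
Qed.

(** Whole periods cancel exactly; only the remainder of [n] modulo [p] contributes. *)
Lemma periodic_bounded zeta (p : nat) : admissible zeta -> (0 < p)%N ->
  iter p sigma zeta = zeta -> exists C, forall n,
  `|birkhoff_sum zeta n - n%:R *: (p%:R^-1 *: birkhoff_sum zeta p)| <= C.
Proof.
move=> azeta p0 per; set rho := _ *: _.
have p0' : p%:R != 0 :> R by rewrite pnatr_eq0 -lt0n.
have perq q : iter (q * p) sigma zeta = zeta.
  by elim: q => // q IH; rewrite mulSn iterD IH per.
have sumq q : birkhoff_sum zeta (q * p) = (q * p)%:R *: rho.
  elim: q => [|q IH]; first by rewrite mul0n scale0r /birkhoff_sum big_ord0.
  rewrite mulSnr birkhoff_sumD perq IH natrD scalerDl; congr (_ + _).
  by rewrite /rho scalerA mulfV // scale1r.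
exists (p%:R * (B + `|rho|)) => n; rewrite (divn_eq n p) birkhoff_sumD perq sumq.
rewrite natrD scalerDl opprD addrACA subrr add0r.
apply: le_trans (ler_normB _ _) _; rewrite normrZ ger0_norm // mulrDr.
have rp : (n %% p)%:R <= p%:R :> R by rewrite ler_nat ltnW // ltn_mod.
apply: lerD; last by rewrite ler_wpM2r.
by apply: le_trans (norm_birkhoff_sum _ azeta) _; rewrite ler_wpM2r // ltW.
Qed.

Lemma large_nat (Q eps : R) : 0 < eps -> exists L : nat, forall n, (L <= n)%N -> Q <= eps * n%:R.
Proof.
move=> eps0; exists (Num.truncn (Q / eps)).+1 => n hn.
rewrite mulrC -ler_pdivrMr //; apply/ltW/(lt_le_trans (truncnS_gt _)).
by rewrite ler_nat.
Qed.

(** A long word approximating [v] is closed up into a periodic sequence. The extra symbol and the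
    two ends of the word cost a constant, negligible for long words. *)
Lemma approachable_periodic v (eps : R) : approachable v -> 0 < eps ->
  exists zeta rho C, [/\ admissible zeta, Defs.periodic zeta, `|rho - v| <= eps &
    forall n, `|birkhoff_sum zeta n - n%:R *: rho| <= C].
Proof.
move=> hv eps0; have eps30 : 0 < eps / 3 by lra.
have [C C0 close] := birkhoff_sum_close eps30.
(* [C] pays for the ends of the word, [B] and the norm of [v] for the joining symbol. *)
have [L hL] := large_nat (C + B + `|v|) eps30.
have [xi [n [axi Ln hn]]] := hv (eps / 3) L.+1 eps30.
have n0 : (0 < n)%N by move: Ln; clear; lia.
have [zeta [azeta per agree]] := periodize_exists axi n0.
have [C' hC'] := periodic_bounded azeta (ltn0Sn n) per.
exists zeta, (n.+1%:R^-1 *: birkhoff_sum zeta n.+1), C'; split=> //.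
  by exists n.+1.
rewrite -/(birkhoff_avg _ _ _) dist_birkhoff_avg ler_pdivrMr ?ltr0n //.
have d1 := close zeta xi n azeta axi agree.
have d2 := phi_bounded (admissible_iter n azeta).
have -> : birkhoff_sum zeta n.+1 = birkhoff_sum zeta n + phi (iter n sigma zeta).
  by rewrite /birkhoff_sum big_ord_recr.
rewrite -natr1.
have -> : birkhoff_sum zeta n + phi (iter n sigma zeta) - (n%:R + 1) *: v =
  (birkhoff_sum zeta n - birkhoff_sum xi n) + (birkhoff_sum xi n - n%:R *: v)
  + (phi (iter n sigma zeta) - v).
  by apply/rowP => l; rewrite !mxE; ring.
have h := hL n (ltnW Ln).
have t1 := ler_normD (birkhoff_sum zeta n - birkhoff_sum xi n + (birkhoff_sum xi n - n%:R *: v))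
  (phi (iter n sigma zeta) - v).
have t2 := ler_normD (birkhoff_sum zeta n - birkhoff_sum xi n) (birkhoff_sum xi n - n%:R *: v).
have t3 := ler_normB (phi (iter n sigma zeta)) v.
lra.
Qed.

(** The periodic approximant gives one sequence valid for every length, so that concatenations can
    prescribe the lengths of their pieces. *)
Lemma approachable_uniform v (eps : R) : approachable v -> 0 < eps ->
  exists xi C, [/\ admissible xi, 0 <= C &
    forall n, `|birkhoff_sum xi n - n%:R *: v| <= eps * n%:R + C].
Proof.
move=> hv eps0; have [xi [rho [C [axi _ d h]]]] := approachable_periodic hv eps0.
exists xi, C; split=> // [|n]; first by apply: le_trans (h 0%N).
have -> : birkhoff_sum xi n - n%:R *: v = (birkhoff_sum xi n - n%:R *: rho) + n%:R *: (rho - v).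
  by apply/rowP => l; rewrite !mxE; ring.
apply: le_trans (ler_normD _ _) _; rewrite addrC; apply: lerD (h n).
by rewrite normrZ ger0_norm // mulrC ler_wpM2r.
Qed.

(** A sequence for [v] is followed during a proportion [1 - t] of the time, then, after a joining
    symbol, one for [w]. *)
Lemma approachable_convex : is_convex approachable.
Proof.
move=> v w t hv hw /andP[t0 t1] eps L eps0.
have e4 : 0 < eps / 4 by lra.
have e2 : 0 < eps / 2 by lra.
have [xi [C1 [axi _ h1]]] := approachable_uniform hv e4.
have [eta [C2 [aeta _ h2]]] := approachable_uniform hw e4.
have [C3 _ close] := birkhoff_sum_close e4.
set u := (1 - t) *: v + t *: w.
(* Collects the errors that do not grow with [n]: both approximations, the ends of both words, the
   joining symbol, the rounding of [(1 - t) * n] and the one extra index. *)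
have [L' hL'] := large_nat (C1 + C2 + 2 * C3 + B + `|v| + `|w| + `|u|) e2.
pose n := maxn L L'.
pose n1 := Num.truncn ((1 - t) * n%:R).
have n1_itv : n1%:R <= (1 - t) * n%:R < n1%:R + 1.
  by rewrite natr1; apply: truncn_itv; rewrite mulr_ge0 //; lra.
have n1n : (n1 <= n)%N.
  rewrite -(ler_nat R); case/andP: n1_itv => le1 _; apply: le_trans le1 _.
  by have := mulr_ge0 t0 (ler0n R n); lra.
pose n2 := (n - n1)%N.
have [zeta [azeta zeta1 zeta2]] := glue_exists n1%:Z axi aeta.
exists zeta, n.+1; split=> //; first by rewrite leqW // leq_maxl.
have nE : n.+1 = (n1 + (1 + n2))%N by rewrite /n2 addnCA subnKC // add1n.
have nR : n%:R = n1%:R + n2%:R :> R by rewrite -natrD subnKC.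
pose z1 := iter n1 sigma zeta; pose z2 := iter 1 sigma z1.
have -> : birkhoff_sum zeta n.+1 = birkhoff_sum zeta n1 + (birkhoff_sum z1 1 + birkhoff_sum z2 n2).
  by rewrite nE !birkhoff_sumD.
have az1 : admissible z1 by exact: admissible_iter.
have az2 : admissible z2 by exact: admissible_iter.
have d1 : `|birkhoff_sum zeta n1 - birkhoff_sum xi n1| <= eps / 4 * n1%:R + C3.
  by apply: close => // i /andP[_ i1]; exact: zeta1.
have d2 : `|birkhoff_sum z2 n2 - birkhoff_sum eta n2| <= eps / 4 * n2%:R + C3.
  apply: close => // i /andP[i0 _]; rewrite -zeta2 // /z2 /z1 !iter_shiftE.
  by congr (zeta _); clear; lia.
have d3 := norm_birkhoff_sum 1 az1.
have g1 := h1 n1; have g2 := h2 n2.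
pose th := (1 - t) * n%:R - n1%:R.
have th01 : `|th| <= 1.
  by rewrite ler_norml /th; case/andP: n1_itv => ? ?; apply/andP; split; lra.
have -> : birkhoff_sum zeta n1 + (birkhoff_sum z1 1 + birkhoff_sum z2 n2) - n.+1%:R *: u =
  (birkhoff_sum zeta n1 - birkhoff_sum xi n1) + (birkhoff_sum xi n1 - n1%:R *: v) +
  (birkhoff_sum z2 n2 - birkhoff_sum eta n2) + (birkhoff_sum eta n2 - n2%:R *: w) +
  birkhoff_sum z1 1 + th *: (w - v) - u.
  rewrite -natr1 nR /u /th nR; apply/rowP => l; rewrite !mxE; ring.
have t6 := ler_normB ((birkhoff_sum zeta n1 - birkhoff_sum xi n1) + (birkhoff_sum xi n1 - n1%:R *: v) +
  (birkhoff_sum z2 n2 - birkhoff_sum eta n2) + (birkhoff_sum eta n2 - n2%:R *: w) +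
  birkhoff_sum z1 1 + th *: (w - v)) u.
have t5 := ler_normD ((birkhoff_sum zeta n1 - birkhoff_sum xi n1) + (birkhoff_sum xi n1 - n1%:R *: v) +
  (birkhoff_sum z2 n2 - birkhoff_sum eta n2) + (birkhoff_sum eta n2 - n2%:R *: w) +
  birkhoff_sum z1 1) (th *: (w - v)).
have t4 := ler_normD ((birkhoff_sum zeta n1 - birkhoff_sum xi n1) + (birkhoff_sum xi n1 - n1%:R *: v) +
  (birkhoff_sum z2 n2 - birkhoff_sum eta n2) + (birkhoff_sum eta n2 - n2%:R *: w))
  (birkhoff_sum z1 1).
have t3 := ler_normD ((birkhoff_sum zeta n1 - birkhoff_sum xi n1) + (birkhoff_sum xi n1 - n1%:R *: v) +
  (birkhoff_sum z2 n2 - birkhoff_sum eta n2)) (birkhoff_sum eta n2 - n2%:R *: w).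
have t2 := ler_normD ((birkhoff_sum zeta n1 - birkhoff_sum xi n1) + (birkhoff_sum xi n1 - n1%:R *: v))
  (birkhoff_sum z2 n2 - birkhoff_sum eta n2).
have t1' := ler_normD (birkhoff_sum zeta n1 - birkhoff_sum xi n1) (birkhoff_sum xi n1 - n1%:R *: v).
have t7 : `|th *: (w - v)| <= `|v| + `|w|.
  rewrite normrZ -[leRHS]mul1r; apply: ler_pM => //.
  by rewrite [leRHS]addrC; exact: ler_normB.
have hn := hL' n (leq_maxr _ _).
rewrite -natr1; move: d1 d2 d3 g1 g2 hn; rewrite nR; lra.
Qed.

(** After the prefix and one joining symbol, a sequence good for [v] is followed long enough to make
    the first [n.+1] terms negligible. *)
Lemma approachable_extend v xi (n : nat) (eps : R) :
  approachable v -> admissible xi -> 0 < eps ->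
  exists zeta n', [/\ admissible zeta, (n < n')%N,
    (forall i : int, i < n%:Z -> zeta i = xi i) &
    `|birkhoff_sum zeta n' - n'%:R *: v| <= eps * n'%:R].
Proof.
move=> hv axi eps0; have e4 : 0 < eps / 4 by lra.
have [eta [C1 [aeta _ h1]]] := approachable_uniform hv e4.
have [C2 _ close] := birkhoff_sum_close e4.
have e2 : 0 < eps / 2 by lra.
have [m hL'] := large_nat (n.+1%:R * (B + `|v|) + C1 + C2) e2.
have [zeta [azeta zeta1 zeta2]] := glue_exists n%:Z axi aeta.
exists zeta, (n.+1 + m)%N; split=> //; first by clear; lia.
rewrite birkhoff_sumD; set z := iter _ _ _.
have az : admissible z by exact: admissible_iter.
have d1 : `|birkhoff_sum z m - birkhoff_sum eta m| <= eps / 4 * m%:R + C2.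
  apply: close => // i /andP[i0 _]; rewrite -zeta2 // /z iter_shiftE.
  by congr (zeta _); clear; lia.
have d2 := norm_birkhoff_sum n.+1 azeta.
have g1 := h1 m.
have -> : birkhoff_sum zeta n.+1 + birkhoff_sum z m - (n.+1 + m)%:R *: v =
  (birkhoff_sum zeta n.+1 - n.+1%:R *: v) + (birkhoff_sum z m - birkhoff_sum eta m) +
  (birkhoff_sum eta m - m%:R *: v).
  by rewrite natrD; apply/rowP => l; rewrite !mxE; ring.
have t1 := ler_normD ((birkhoff_sum zeta n.+1 - n.+1%:R *: v) + (birkhoff_sum z m - birkhoff_sum eta m))
  (birkhoff_sum eta m - m%:R *: v).
have t2 := ler_normD (birkhoff_sum zeta n.+1 - n.+1%:R *: v) (birkhoff_sum z m - birkhoff_sum eta m).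
have t3 := ler_normB (birkhoff_sum zeta n.+1) (n.+1%:R *: v).
rewrite normrZ (ger0_norm (ler0n R _)) in t3.
have hm := hL' m (leqnn m).
have en : 0 <= eps * n.+1%:R by rewrite mulr_ge0 // ltW.
rewrite natrD; move: d1 d2 g1 t1 t2 t3 hm en; rewrite mulrDr; lra.
Qed.

(** Extending a word repeatedly, with precision [k.+1%:R^-1] at stage [k], yields a limit sequence
    whose averages at the stage lengths tend to [v]. *)
Lemma approachable_gen_rotation v : approachable v -> gen_rotation_set phi v.
Proof.
move=> hv; have [xi0 [_ [axi0 _ _]]] := approachable_uniform hv ltr01.
pose good (x : (int -> 'I_s) * nat * nat) (y : (int -> 'I_s) * nat) :=
  admissible x.1.1 -> [/\ admissible y.1, (x.1.2 < y.2)%N,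
    (forall i : int, i < x.1.2%:Z -> y.1 i = x.1.1 i) &
    `|birkhoff_sum y.1 y.2 - y.2%:R *: v| <= x.2.+1%:R^-1 * y.2%:R].
have /choice[F hF] : forall x, exists y, good x y.
  (* For inadmissible [xi] the premise of [good] fails and any value will do. *)
  move=> [[xi n] k]; have [axi|nxi] := pselect (admissible xi); last by exists (xi, n).
  have e0 : 0 < k.+1%:R^-1 :> R by rewrite invr_gt0 ltr0n.
  have [zeta [n' [azeta nn' agree d]]] := approachable_extend n hv axi e0.
  by exists (zeta, n').
pose fix z k := if k is k'.+1 then F (z k', k') else (xi0, 0%N).
have az k : admissible (z k).1.
  by elim: k => // k IH; have [] := hF (z k, k) IH.
have zlt k : ((z k).2 < (z k.+1).2)%N by have [] := hF (z k, k) (az k).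
have zext k (i : int) : i < (z k).2%:Z -> (z k.+1).1 i = (z k).1 i.
  by have [_ _ + _] := hF (z k, k) (az k); apply.
have zsum k : `|birkhoff_sum (z k.+1).1 (z k.+1).2 - (z k.+1).2%:R *: v| <=
    k.+1%:R^-1 * (z k.+1).2%:R.
  by have [] := hF (z k, k) (az k).
have zge k : (k <= (z k).2)%N.
  by elim: k => // k IH; apply: leq_ltn_trans IH (zlt k).
have zmono k d : ((z k).2 <= (z (k + d)%N).2)%N.
  elim: d => [|d IH]; first by rewrite addn0.
  by rewrite addnS (leq_trans IH) // ltnW.
have zstable k d (i : int) : i < (z k).2%:Z -> (z (k + d)%N).1 i = (z k).1 i.
  move=> ik; elim: d => [|d IH]; first by rewrite addn0.
  by rewrite addnS zext // (lt_le_trans ik) // lez_nat.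
(* The length at stage [k] is at least [k], so the symbol at [i] is already final at this stage. *)
pose zeta (i : int) := (z `|i|%N.+1).1 i.
have zetaE k (i : int) : i < (z k).2%:Z -> zeta i = (z k).1 i.
  move=> ik; have ii : i < (z `|i|%N.+1).2%:Z.
    by have := zge `|i|%N.+1; move: (z _).2 => j; clear; lia.
  rewrite /zeta; case: (leqP k `|i|%N.+1) => le_k.
    by rewrite -(subnKC le_k) zstable.
  by rewrite -(subnKC (ltnW le_k)) zstable.
have azeta : admissible zeta.
  move=> i; have := zge `|i|%N.+2 => hi.
  rewrite (zetaE `|i|%N.+2 i); last by move: hi; move: (z _).2 => j; clear; lia.
  rewrite (zetaE `|i|%N.+2 (i + 1)); first exact: az.
  by move: hi; move: (z _).2 => j; clear; lia.
(* The predecessor compensates for the successor built into the averages of [gen_rotation_set]. *)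
exists zeta; split=> //; exists (fun k => (z k.+1).2.-1).
have nkE k : (z k.+1).2.-1.+1 = (z k.+1).2.
  by rewrite prednK // (leq_trans _ (zge k.+1)).
split=> [k|].
  by rewrite nkE -ltnS nkE; exact: zlt.
apply/cvgrPdist_le => eps eps0; have e3 : 0 < eps / 3 by lra.
have [C _ close] := birkhoff_sum_close e3.
have [L1 hL1] := large_nat C e3; have [L2 hL2] := large_nat 1 e3.
exists (maxn L1 L2) => // k /= hk.
rewrite distrC dist_birkhoff_avg nkE ler_pdivrMr ?ltr0n ?(leq_trans _ (zge k.+1)) //.
have zk := zge k.+1.
have d1 : `|birkhoff_sum zeta (z k.+1).2 - birkhoff_sum (z k.+1).1 (z k.+1).2| <=
    eps / 3 * (z k.+1).2%:R + C.
  by apply: close => // i /andP[_ ik]; exact: zetaE.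
have d2 := zsum k.
have c1 : C <= eps / 3 * (z k.+1).2%:R.
  by apply: hL1; move: zk hk; move: (z _).2 => j; clear; lia.
have c2 : k.+1%:R^-1 * (z k.+1).2%:R <= eps / 3 * (z k.+1).2%:R.
  rewrite ler_wpM2r // -[leLHS]mul1r ler_pdivrMr ?ltr0n //.
  by apply: hL2; move: hk; clear; lia.
have t := ler_distD (birkhoff_sum (z k.+1).1 (z k.+1).2)
  (birkhoff_sum zeta (z k.+1).2) ((z k.+1).2%:R *: v).
have d3 := le_trans d2 c2; apply: le_trans t _; apply: le_trans (lerD d1 d3) _.
by move: c1; move: (z k.+1).2 => q; lra.
Qed.

End Symbolic.

(** Dividing by the total weight lets the induction remove the last point while carrying only
    positivity of the sum. *)
Lemma convex_sum (R : realType) (N : nat) (A : set 'rV[R]_N) : is_convex A ->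
  forall (k : nat) (v : 'I_k -> 'rV[R]_N) (t : 'I_k -> R),
  (forall j, A (v j)) -> (forall j, 0 <= t j) -> 0 < \sum_j t j ->
  A ((\sum_j t j)^-1 *: \sum_j t j *: v j).
Proof.
move=> cA; elim=> [|k IH] v t Av t0; first by rewrite big_ord0 ltxx.
rewrite !big_ord_recr /=; set T := \sum_(_ < k) _; set a := t ord_max; set w := v ord_max.
move=> Ta0; have T0 : 0 <= T by exact: sumr_ge0.
have a0 : 0 <= a by exact: t0.
(* If the earlier weights sum to 0 they all vanish, and the combination is the last point. *)
have [TE|Tpos] := eqVneq T 0.
  rewrite big1 => [|i _]; last first.
    by rewrite (psumr_eq0P (fun j _ => t0 _) TE) ?scale0r.
  rewrite TE !add0r in Ta0 *.
  by rewrite scalerA mulVf ?gt_eqF // scale1r; exact: Av.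
have Tpos' : 0 < T by rewrite lt0r Tpos.
have Ak := IH (fun j => v (widen_ord (leqnSn k) j)) (fun j => t (widen_ord (leqnSn k) j))
  (fun j => Av _) (fun j => t0 _) Tpos'.
have := cA _ _ (a / (T + a)) Ak (Av ord_max).
have -> : 0 <= a / (T + a) <= 1.
  by rewrite divr_ge0 ?(ltW Ta0) //= ler_pdivrMr // mul1r lerDr.
move=> /(_ isT); congr A.
have -> : 1 - a / (T + a) = T / (T + a).
  by rewrite -[X in X - _](@divff _ (T + a)) ?gt_eqF // -mulrBl addrK.
rewrite -/T -/w scalerDr !scalerA; congr (_ *: _ + _ *: _); last by rewrite mulrC.
by rewrite mulrAC mulfV ?mul1r.
Qed.

Theorem theorem1 (R : realType) (N s : nat) (K : 'I_s -> set 'rV[R]_N)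
    (phi : (int -> 'I_s) -> 'rV[R]_N) :
  (2 <= N)%N -> (3 <= s)%N ->
  open_billiard K ->
  is_coding_observable K phi ->
  is_convex (gen_rotation_set phi) /\
  periodic_rotation_hull phi `<=` gen_rotation_set phi /\
  gen_rotation_set phi `<=` closure (periodic_rotation_hull phi).
Proof.
move=> _ s3 hK hphi.
have close := observable_close hK hphi.
have [B B0 bounded] := observable_bounded hK hphi.
(* Convexity and periodic approximation are both read off from this description. *)
have genE : gen_rotation_set phi = approachable phi.
  apply/seteqP; split=> v; first exact: gen_rotation_approachable.
  exact: (approachable_gen_rotation s3 close B0 bounded).
have convex : is_convex (gen_rotation_set phi).
  by rewrite genE; exact: (approachable_convex s3 close B0 bounded).
split=> //; split.
- move=> _ [k [xis [v [t [k0 per rot [t0 t1] ->]]]]].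
  rewrite -[X in gen_rotation_set _ X]scale1r -[1 in X in gen_rotation_set _ X]invr1 -t1.
  apply: (convex_sum convex) => //; last by rewrite t1.
  move=> j; exists (xis j); split; first by have [] := per j.
  by exists id; split=> //; exact: rot.
- move=> v; rewrite genE => hv U /nbhs_ballP[eps /= eps0 hU].
  have e2 : 0 < eps / 2 by rewrite divr_gt0.
  have [zeta [rho [C [azeta per d h]]]] :=
    approachable_periodic s3 close B0 bounded hv e2.
  exists rho; split; last first.
    by apply: hU; rewrite -ball_normE /= distrC; apply: le_lt_trans d _; lra.
  (* A single periodic sequence already approximates [v], so the combination is trivial. *)
  exists 1%N, (fun=> zeta), (fun=> rho), (fun=> 1); split=> //.
  + by move=> _; exact: bounded_rotation_vector h.
  + by split=> //; rewrite big_ord1.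
  + by rewrite big_ord1 scale1r.
Qed.
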